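(* For every $n$ and every $D\le n^{1/11}$, there exists an unweighted directed graph $G$ with $\Theta(n)$ vertices and diameter $D$ such that every subgraph $H$ of $G$ on the same vertex set with $\mathrm{diam}(H)<\frac{5}{3}\mathrm{diam}(G)-1$ contains $\Omega(n^{4/3}D^{1/3})$ edges.
   Context: $d_G(u,v)$ is the directed shortest-path distance and $\mathrm{diam}(G)=\max_{u,v}d_G(u,v)$. A subgraph of $G=(V,E)$ is a graph $(V,E')$ with $E'\subseteq E$. *)

(* Defs.v *)
From mathcomp Require Import all_boot.
Set Implicit Arguments. Unset Strict Implicit. Unset Printing Implicit Defensive.

Definition walk_le (T : finType) (e : rel T) (u v : T) (k : nat) : Prop :=
  exists p : seq T, [/\ path e u p, last u p = v & size p <= k].

Definition dist_is (T : finType) (e : rel T) (u v : T) (d : nat) : Prop :=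
  walk_le e u v d /\ forall k, walk_le e u v k -> d <= k.

(* diam(G) = D: every distance is finite and at most D, and some pair
   is at distance exactly D (i.e. D = max_{u,v} d_G(u,v)). A graph that is
   not strongly connected has infinite diameter: diam_is e D holds for no D. *)
Definition diam_is (T : finType) (e : rel T) (D : nat) : Prop :=
  (forall u v, walk_le e u v D) /\ exists u v, dist_is e u v D.

Definition nedges (T : finType) (e : rel T) : nat :=
  #|[set x : T * T | e x.1 x.2]|.

(* Main.v *)
Require Import Defs.
From mathcomp Require Import all_boot.
From mathcomp Require Import zify.

Set Implicit Arguments.
Unset Strict Implicit.
Unset Printing Implicit Defensive.

(** Let q^2 D be about n.  A vertex is a point of one of 5 q^2 directed lines, all
    indexed by pairs in [q]^2 and all with about D/3 vertices: two source lines,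
    a middle line and two sink lines.  The fast route S1(u) -> X(i) -> T2(v) has
    length D; it uses an edge S1(u) -> X(i) with i.1 = u.1 and an edge
    X(i) -> T2(v) with i.2 = v.1, so that i = (u.1, v.1) is forced.  The other
    edges into and out of X(i), available for all indices, start from S2(u) or
    end in T1(v) and cost one more line.  Together with edges going back they
    give diameter D.
    A route from S1(u) to T2(v) that is shorter than 5D/3 - 1 visits a single
    middle line and takes at most one of the two slow detours, hence it uses an
    edge X(i) -> T(v) with i.1 = u.1 or an edge S(u) -> X(i) with i.2 = v.1.  An
    edge of either kind serves only q of the q^4 pairs (u, v), so a subgraph of
    small diameter has at least q^3 edges, and D^11 <= n turns this into the
    bound n^(4/3) D^(1/3). *)

(** * Bounded walks and potentials *)

Section Walks.
Variables (T : finType) (e : rel T).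

Lemma walk_le_refl x : walk_le e x x 0.
Proof. by exists [::]. Qed.

Lemma walk_le0 x y : walk_le e x y 0 -> x = y.
Proof. by case=> [[|z p] []]. Qed.

Lemma walk_le_edge x y : e x y -> walk_le e x y 1.
Proof. by move=> exy; exists [:: y]; rewrite /= exy. Qed.

Lemma walk_le_weaken k x y l : walk_le e x y k -> k <= l -> walk_le e x y l.
Proof.
by move=> [p [ep lp sp]] le_kl; exists p; split => //; apply: leq_trans le_kl.
Qed.

Lemma walk_le_trans k l y x z :
  walk_le e x y k -> walk_le e y z l -> walk_le e x z (k + l).
Proof.
move=> [p [ep lp sp]] [r [er lr sr]]; exists (p ++ r).
by rewrite cat_path last_cat size_cat ep lp er lr leq_add.
Qed.

(** Source of all lower bounds on distances: a potential that climbs by at most one per edge,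
    applied to [level] in the graph and to [arrival] in a subgraph. *)
Lemma potential_walk_le (f : T -> nat) x y k :
  (forall v w, e v w -> f w <= (f v).+1) -> walk_le e x y k -> f y <= f x + k.
Proof.
move=> f_lip [p [ep <- sp]]; apply: leq_trans (_ : f x + size p <= _); last first.
  by rewrite leq_add2l.
elim: p x ep {sp} => [|v p IHp] x /=; first by rewrite addn0.
move=> /andP[/f_lip le_fv /IHp le_fp]; apply: leq_trans le_fp _.
by rewrite addnS -addSn leq_add2r.
Qed.

Lemma walk_le_line n (g : 'I_n.+1 -> T) (i j : 'I_n.+1) :
    (forall s t : 'I_n.+1, t = s.+1 :> nat -> e (g s) (g t)) ->
  i <= j -> walk_le e (g i) (g j) (j - i).
Proof.
move=> eg; have [d] := ubnP (j - i); elim: d j => // d IHd j lt_d le_ij.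
have [eq_ij | ne_ij] := eqVneq i j.
  by rewrite eq_ij subnn; apply: walk_le_refl.
have lt_ij : i < j by rewrite ltn_neqAle ne_ij.
have lt_j' : j.-1 < n.+1 by have := ltn_ord j; lia.
pose j' := Ordinal lt_j'.
have -> : j - i = (j' - i) + 1 by rewrite /=; lia.
apply: (@walk_le_trans _ _ (g j')); first by apply: IHd; rewrite /=; lia.
by apply/walk_le_edge/eg; rewrite /=; lia.
Qed.

End Walks.

(** * The graph and its diameter *)

Section Construction.
Variables (I : finType) (a c : nat).

(* The lines S1, S2 (first component false, true), then T1, T2, then X. *)
Definition vertex : finType :=
  (bool * (I * I) * 'I_a.+1 + bool * (I * I) * 'I_a.+1 + (I * I) * 'I_c.+1)%type.

Definition src k u j : vertex := inl (inl (k, u, j)).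
Definition snk k v j : vertex := inl (inr (k, v, j)).
Definition mid i j : vertex := inr (i, j).

Lemma card_vertex : #|vertex| = #|I| ^ 2 * (4 * a.+1 + c.+1).
Proof. by rewrite !card_sum !card_prod card_bool !card_ord; lia. Qed.

Lemma vertex_case (P : vertex -> Prop) :
    (forall k u j, P (src k u j)) -> (forall k v j, P (snk k v j)) ->
    (forall i j, P (mid i j)) ->
  forall x, P x.
Proof.
move=> Psrc Psnk Pmid [[[[k u] j]|[[k v] j]]|[i j]].
- exact: Psrc.
- exact: Psnk.
- exact: Pmid.
Qed.

Definition next_in_chain (x y : bool * (I * I) * 'I_a.+1) : bool :=
  let: (k, u, j) := x in let: (k', u', j') := y in
  (u == u') && ((k == k') && (j' == j.+1 :> nat)
                || [&& ~~ k, k', j == a :> nat & j' == 0 :> nat]).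

Definition edge : rel vertex := fun x y =>
  match x, y with
  | inl (inl s), inl (inl s') => next_in_chain s s'
  | inl (inl (k, u, j)), inr (i, j') =>
      [&& j == a :> nat, j' == 0 :> nat & k || (i.1 == u.1)]
  | inr (i, j), inr (i', j') => (i == i') && (j' == j.+1 :> nat)
  | inr (i, j), inl (inl (k, u, j')) =>
      (j' == 0 :> nat) && (if k then j == c :> nat else c <= j.+1)
  | inr (i, j), inl (inr (k, v, j')) =>
      [&& j == c :> nat, j' == 0 :> nat & k ==> (i.2 == v.1)]
  | inl (inr t), inl (inr t') => next_in_chain t t'
  | inl (inr (k, v, j)), inr (i, j') => (j == a :> nat) && (j' == 0 :> nat)
  | _, _ => false
  end.

Lemma next_in_chain_irreflexive : irreflexive next_in_chain.
Proof. by move=> [[[] u] j] /=; rewrite !eqxx /=; apply/negbTE; lia. Qed.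

Lemma edge_irreflexive : irreflexive edge.
Proof.
case=> [[[[k u] j]|[[k v] j]]|[i j]].
- exact: (next_in_chain_irreflexive (k, u, j)).
- exact: (next_in_chain_irreflexive (k, v, j)).
- by rewrite /= eqxx /=; apply/negbTE; lia.
Qed.

Lemma src_line k u (i j : 'I_a.+1) :
  i <= j -> walk_le edge (src k u i) (src k u j) (j - i).
Proof. by apply: walk_le_line => s t /= ->; rewrite !eqxx. Qed.

Lemma snk_line k v (i j : 'I_a.+1) :
  i <= j -> walk_le edge (snk k v i) (snk k v j) (j - i).
Proof. by apply: walk_le_line => s t /= ->; rewrite !eqxx. Qed.

Lemma mid_line i (j l : 'I_c.+1) :
  j <= l -> walk_le edge (mid i j) (mid i l) (l - j).
Proof. by apply: walk_le_line => s t /= ->; rewrite !eqxx. Qed.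

Lemma src_to_mid k u j i :
  k || (i.1 == u.1) -> walk_le edge (src k u j) (mid i ord0) (a.+1 - j).
Proof.
move=> hk; have le_ja : j <= (ord_max : 'I_a.+1) by have := ltn_ord j; rewrite /=; lia.
have -> : a.+1 - j = (a - j) + 1 by have := ltn_ord j; lia.
apply: walk_le_trans (src_line k u le_ja) _.
by apply: walk_le_edge; rewrite /= !eqxx.
Qed.

Lemma snk_to_mid k v j i : walk_le edge (snk k v j) (mid i ord0) (a.+1 - j).
Proof.
have le_ja : j <= (ord_max : 'I_a.+1) by have := ltn_ord j; rewrite /=; lia.
have -> : a.+1 - j = (a - j) + 1 by have := ltn_ord j; lia.
apply: walk_le_trans (snk_line k v le_ja) _.
by apply: walk_le_edge; rewrite /= !eqxx.
Qed.

Lemma end_to_src i k u j : walk_le edge (mid i ord_max) (src k u j) j.+1.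
Proof.
rewrite -(subn0 j) -add1n; apply: walk_le_trans (@src_line k u ord0 _ _) => //.
by apply: walk_le_edge; rewrite /= !eqxx leqnSn; case: k.
Qed.

Lemma end_to_snk i k v j :
  k ==> (i.2 == v.1) -> walk_le edge (mid i ord_max) (snk k v j) j.+1.
Proof.
move=> hk; rewrite -(subn0 j) -add1n.
apply: walk_le_trans (@snk_line k v ord0 _ _) => //.
by apply: walk_le_edge; rewrite /= !eqxx.
Qed.

Lemma snk_chain v j : walk_le edge (snk false v ord0) (snk true v j) (a + j.+1).
Proof.
have := @snk_line false v ord0 ord_max isT; rewrite /= subn0.
move=> /walk_le_trans; apply.
rewrite -(subn0 j) -add1n; apply: walk_le_trans (@snk_line true v ord0 _ _) => //.
by apply: walk_le_edge; rewrite /= !eqxx.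
Qed.

Lemma src_chain u j i : walk_le edge (src false u j) (mid i ord0) (a.+1 + a.+1).
Proof.
have le_ja : j <= (ord_max : 'I_a.+1) by have := ltn_ord j; rewrite /=; lia.
have := src_line false u le_ja; move=> /walk_le_weaken /(_ (leq_subr _ _)) w1.
apply: walk_le_weaken (_ : walk_le _ _ _ (a + (1 + a.+1))) _; last by lia.
apply: walk_le_trans w1 _; apply: (@walk_le_trans _ _ _ _ (src true u ord0)).
  by apply: walk_le_edge; rewrite /= !eqxx.
by have := @src_to_mid true u ord0 i isT; rewrite subn0.
Qed.

Lemma mid_to_end i j : walk_le edge (mid i j) (mid i ord_max) c.
Proof.
apply: walk_le_weaken (mid_line _ _) _; last exact: leq_subr.
by have := ltn_ord j; rewrite /=; lia.
Qed.

(* [edge] lets S1 be entered already from the last but one vertex of a middle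
   line ([c <= j.+1]), without which the diameter is too large by one when
   [c = a.+1]. *)
Lemma mid_to_src0 i j u : walk_le edge (mid i j) (src false u ord0) (maxn 1 c).
Proof.
have lt_c' : c.-1 < c.+1 by lia.
pose l : 'I_c.+1 := Ordinal lt_c'.
have [le_jl | lt_lj] := leqP j l.
  apply: walk_le_weaken (_ : walk_le _ _ _ (l - j + 1)) _; last first.
    by move: le_jl; rewrite /=; lia.
  apply: walk_le_trans (mid_line _ le_jl) _; apply: walk_le_edge => /=; lia.
apply: walk_le_weaken (leq_maxl _ _); apply: walk_le_edge => /=.
move: lt_lj; rewrite /=; lia.
Qed.

Definition is_mid (x : vertex) : bool := if x is inr _ then true else false.

(** An edge out of S1(u) prescribes only [i.1], so [i.2] can be matched to the sink line to be
    entered next. *)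
Lemma to_mid_snd x w :
  ~~ is_mid x -> exists2 i, i.2 = w & walk_le edge x (mid i ord0) a.+1.
Proof.
case: x => [[[[k u] j]|[[k v] j]]|//] _.
  exists (u.1, w) => //; apply: walk_le_weaken (src_to_mid _ _) (leq_subr _ _).
  by rewrite /= eqxx orbT.
by exists (w, w) => //; apply: walk_le_weaken (snk_to_mid k v j _) (leq_subr _ _).
Qed.

Lemma to_mid x i : ~~ is_mid x -> walk_le edge x (mid i ord0) (a.+1 + a.+1).
Proof.
case: x => [[[[[] u] j]|[[k v] j]]|//] _; last 1 first.
- by apply: walk_le_weaken (snk_to_mid k v j i) _; lia.
- by apply: walk_le_weaken (@src_to_mid true u j i isT) _; lia.
- exact: src_chain.
Qed.

(** Position along the fast route. S2 is laid beside X and T1 beside T2, so that slow detours and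
    back edges gain nothing. *)
Definition level (x : vertex) : nat :=
  match x with
  | inl (inl (k, _, j)) => k * a.+1 + j
  | inr (_, j) => a.+1 + j
  | inl (inr (_, _, j)) => a + c + 2 + j
  end.

Lemma level_edge x y : edge x y -> level y <= (level x).+1.
Proof.
elim/vertex_case: x => [k u j|k u j|i j];
  elim/vertex_case: y => [k' u' l|k' u' l|i' l] //=;
  have := ltn_ord j; have := ltn_ord l;
  [case: k; case: k' | case: k | case: k; case: k' | case: k | case: k'
   | case: k' | ] => /=; lia.
Qed.

Hypothesis c_small : c <= a.+1.

Lemma edge_walk_le x y : walk_le edge x y (2 * a + c + 2).
Proof.
have [midx | nmidx] := boolP (is_mid x).
  elim/vertex_case: x midx => // i j _.
  elim/vertex_case: y => [k u l|k v l|i' l]; have := ltn_ord l => lt_l.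
  - apply: walk_le_weaken
      (walk_le_trans (mid_to_end i j) (end_to_src i k u l)) _; lia.
  - have w1 := walk_le_trans (mid_to_end i j)
      (@end_to_snk i false v ord0 isT).
    case: k; last first.
      apply: walk_le_weaken (walk_le_trans (mid_to_end i j)
        (@end_to_snk i false v l isT)) _; lia.
    apply: walk_le_weaken (walk_le_trans w1 (snk_chain v l)) _.
    by rewrite /=; lia.
  (* Between middle lines, the way back is an S1 line matching [i'.1]; the total
     [maxn 1 c + a.+1 + l] is small enough because [c <= a.+1]. *)
  - have h : false || (i'.1 == (i'.1, i'.1).1) by rewrite /= eqxx.
    have w1 := walk_le_trans (mid_to_src0 i j (i'.1, i'.1))
      (src_to_mid ord0 h).
    apply: walk_le_weaken
      (walk_le_trans w1 (@mid_line i' ord0 l isT)) _.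
    by rewrite /=; lia.
elim/vertex_case: y => [k u l|k v l|i l]; have := ltn_ord l => lt_l.
- have [i _ w1] := to_mid_snd u.1 nmidx.
  have w2 := walk_le_trans w1 (mid_to_end i ord0).
  apply: walk_le_weaken (walk_le_trans w2 (end_to_src i k u l)) _; lia.
- have [i iv w1] := to_mid_snd v.1 nmidx.
  have w2 := walk_le_trans w1 (mid_to_end i ord0).
  have h : k ==> (i.2 == v.1) by rewrite iv eqxx implybT.
  apply: walk_le_weaken (walk_le_trans w2 (end_to_snk l h)) _; lia.
- apply: walk_le_weaken (walk_le_trans (to_mid i nmidx)
    (@mid_line i ord0 l isT)) _; rewrite /=; lia.
Qed.

Lemma diam_edge (i0 : I) : diam_is edge (2 * a + c + 2).
Proof.
split; first exact: edge_walk_le.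
exists (src false (i0, i0) ord0), (snk true (i0, i0) ord_max).
split; first exact: edge_walk_le.
by move=> k /(potential_walk_le level_edge) /=; lia.
Qed.

(** * Subgraphs missing all useful edges for one pair *)

Section LowerBound.
Variables (h : rel vertex) (u v : I * I).
Hypothesis h_sub : forall x y, h x y -> edge x y.
Hypothesis h_u_mid : forall k j i l, i.2 = v.1 -> ~~ h (src k u j) (mid i l).
Hypothesis h_mid_v : forall i j k l, i.1 = u.1 -> ~~ h (mid i j) (snk k v l).
Hypothesis a_small : a <= c.+2.

(* A lower bound for the distance in [h] from the first vertex of S1(u). *)
Definition arrival (x : vertex) : nat :=
  match x with
  | inl (inl (k, u', j)) =>
      (if u' == u then k * a.+1 else a + c + 1 + k) + j
  | inr (i, j) =>
      (if i.1 == u.1 then a.+1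
       else if i.2 == v.1 then 2 * a + c + 2 else 2 * a + 2) + j
  | inl (inr (k, v', j)) =>
      (if v' == v then 2 * a + c + 3 + k * c else a + c + 2) + j
  end.

(** A middle line with [i.1 = u.1] is reached directly, one with [i.2 = v.1] only after crossing
    another middle line, and the rest through S2(u) at the earliest. T2(v) is entered from a line
    with [i.2 = v.1], or from T1(v), which is no faster since [c <= a.+1]. *)
Lemma arrival_edge x y : h x y -> arrival y <= (arrival x).+1.
Proof.
move=> hxy; move: (hxy) => /h_sub.
elim/vertex_case: x hxy => [k u' j|k v' j|i j];
  elim/vertex_case: y => [k' u'' l|k' v'' l|i' l] // hxy;
  have := ltn_ord j; have := ltn_ord l => /= lt_l lt_j.
- case/andP=> /eqP <-; case: (u' == u); move: k {hxy} => [] //=; case: k' => //=; lia.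
- case: (u' =P u) hxy => [-> hxy | _ _]; last first.
    by case: (i'.1 == u.1); case: (i'.2 == v.1); case: k => /=; lia.
  case: (i'.2 =P v.1) => [ei|_]; first by rewrite (negbTE (h_u_mid _ _ _ ei)) in hxy.
  by move: k {hxy} => [] /=; case: (i'.1 == u.1) => /=; lia.
- case/andP=> /eqP <-; case: (v' == v); move: k {hxy} => [] //=; case: k' => //=; lia.
- by case: (v' == v); case: (i'.1 == u.1); case: (i'.2 == v.1); move: k {hxy} => [] /=; lia.
- by case: (i.1 == u.1); case: (i.2 == v.1); case: (u'' == u); move: k' {hxy} => [] /=; lia.
- case: (v'' =P v) hxy => [-> hxy | _ _]; last first.
    by case: (i.1 == u.1); case: (i.2 == v.1); case: k' => /=; lia.
  case: (i.1 =P u.1) => [ei|_]; first by rewrite (negbTE (h_mid_v _ _ _ ei)) in hxy.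
  by move: k' {hxy} => [] /=; case: (i.2 == v.1) => /=; lia.
- by case/andP=> /eqP <- /eqP ->; lia.
Qed.

Lemma diam_lower_bound d : diam_is h d -> 3 * a + 2 * c + 3 <= d.
Proof.
case=> /(_ (src false u ord0) (snk true v ord_max)).
by move=> /(potential_walk_le arrival_edge) /=; rewrite !eqxx; lia.
Qed.

End LowerBound.

(** * Counting edges *)

Section EdgeCount.
Variable h : rel vertex.
Hypothesis h_sub : forall x y, h x y -> edge x y.
Hypothesis a_small : a <= c.+2.

(** A useful edge determines one of u, v and the first coordinate of the other; the extra index
    supplies the missing second coordinate. *)
Definition pair_of_edge (z : vertex * vertex * I) : option ((I * I) * (I * I)) :=
  match z with
  | (inl (inl (_, u, _)), inr (i, _), r) => Some (u, (i.2, r))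
  | (inr (i, _), inl (inr (_, v, _)), r) => Some ((i.1, r), v)
  | _ => None
  end.

Lemma nedges_lower_bound d :
  diam_is h d -> d < 3 * a + 2 * c + 3 -> #|I| ^ 3 <= nedges h.
Proof.
move=> diam_h lt_d.
pose E := [set xy : vertex * vertex | h xy.1 xy.2].
have sub : [set Some uv | uv in [set: (I * I) * (I * I)]]
    \subset [set pair_of_edge z | z in setX E [set: I]].
  apply/subsetP => _ /imsetP[[u v] _ ->].
  have [/existsP[[[[k j] i] l] /andP[/eqP ei hk]] | nP] := boolP
      [exists z : bool * 'I_a.+1 * (I * I) * 'I_c.+1,
        (z.1.2.2 == v.1) && h (src z.1.1.1 u z.1.1.2) (mid z.1.2 z.2)].
    apply/imsetP; exists (src k u j, mid i l, v.2); first by rewrite !inE andbT.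
    by rewrite /= ei -surjective_pairing.
  have [/existsP[[[[i j] k] l] /andP[/eqP ei hk]] | nQ] := boolP
      [exists z : (I * I) * 'I_c.+1 * bool * 'I_a.+1,
        (z.1.1.1.1 == u.1) && h (mid z.1.1.1 z.1.1.2) (snk z.1.2 v z.2)].
    apply/imsetP; exists (mid i j, snk k v l, u.2); first by rewrite !inE andbT.
    by rewrite /= ei -surjective_pairing.
  suff : 3 * a + 2 * c + 3 <= d by rewrite leqNgt lt_d.
  apply: (@diam_lower_bound h u v) => // [k j i l ei|i j k l ei].
    move: nP; rewrite negb_exists => /forallP/(_ (k, j, i, l)).
    by rewrite /= ei eqxx.
  by move: nQ; rewrite negb_exists => /forallP/(_ (i, j, k, l)); rewrite /= ei eqxx.
(* All [#|I| ^ 4] pairs are decoded from [nedges h * #|I|] inputs; one factor cancels. *)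
move: (leq_trans (subset_leq_card sub) (leq_imset_card _ _)).
rewrite card_imset; last by move=> ? ? [].
rewrite cardsX !cardsT !card_prod -/(nedges h).
have [-> // | I_gt0] := posnP #|I|.
have -> : #|I| * #|I| * (#|I| * #|I|) = #|I| ^ 3 * #|I|.
  by rewrite !expnS expn0 muln1 !mulnA.
by rewrite leq_pmul2r.
Qed.

End EdgeCount.

End Construction.

(** * Choice of parameters *)

Lemma exists_square_scale n D :
  0 < D -> D <= n -> exists2 q, 0 < q & q ^ 2 * D <= n < q.+1 ^ 2 * D.
Proof.
move=> D_gt0 le_Dn.
have exq : exists q, q ^ 2 * D <= n by exists 1; rewrite mul1n.
have bq q : q ^ 2 * D <= n -> q <= n.
  move=> le_qn; apply: leq_trans le_qn; case: q => // q.
  by rewrite expnS expn1 -mulnA leq_pmulr // muln_gt0.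
case: (ex_maxnP exq bq) => q le_qn maxq.
exists q; first by apply: maxq; rewrite mul1n.
by rewrite le_qn ltnNge; apply/negP => /maxq; rewrite ltnn.
Qed.

(** Squared and multiplied by [D ^ 9], the claim becomes [n ^ 8 * D ^ 11 <= n ^ 9 <= (4 * q ^ 2 * D)
    ^ 9], and [512 ^ 2 = 4 ^ 9]. *)
Lemma edge_bound_arith n D q M :
  0 < D -> D ^ 11 <= n -> n <= 4 * q ^ 2 * D -> q ^ 3 <= M ->
  n ^ 4 * D <= 512 * M ^ 3.
Proof.
move=> D_gt0 le_Dn le_nq le_qM.
apply: leq_trans (_ : 512 * q ^ 9 <= _); last first.
  by rewrite leq_mul2l (expnM q 3 3) leq_exp2r.
rewrite -(@leq_exp2r _ _ 2) // -(@leq_pmul2r (D ^ 9)) ?expn_gt0 ?D_gt0 //.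
have -> : (n ^ 4 * D) ^ 2 * D ^ 9 = n ^ 8 * D ^ 11.
  by rewrite expnMn -expnM -mulnA -expnD.
have -> : (512 * q ^ 9) ^ 2 * D ^ 9 = (4 * q ^ 2 * D) ^ 9.
  have sq512 : 512 ^ 2 = 4 ^ 9 := etrans (esym (expnM 2 9 2)) (expnM 2 2 9).
  rewrite (expnMn 512 (q ^ 9)) (expnMn (4 * q ^ 2) D) (expnMn 4 (q ^ 2)).
  by rewrite sq512 -(expnM q 9 2) -(expnM q 2 9).
apply: leq_trans (_ : n ^ 9 <= _); last by rewrite leq_exp2r.
by rewrite (expnSr n 8) leq_mul2l le_Dn orbT.
Qed.

Lemma diam_complete n : 2 <= n -> diam_is (fun x y : 'I_n => x != y) 1.
Proof.
case: n => [|[|n]] // _; split=> [x y|].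
  have [-> | ne_xy] := eqVneq x y; last exact: walk_le_edge.
  exact: walk_le_weaken (walk_le_refl _ _) _.
exists ord0, ord_max; split=> [|[|k] //]; first exact: walk_le_edge.
by move=> /walk_le0 /(congr1 (@nat_of_ord _)).
Qed.

(* Constants a, b (Theta(n) vertices), c (Omega bound, written cubed:
   c * |E(H)|^3 >= n^4 * D  <=>  |E(H)| >= c^(-1/3) n^(4/3) D^(1/3)),
   threshold n0 for the asymptotics. D <= n^(1/11) is D^11 <= n.
   diam(H) < 5/3 diam(G) - 1 with diam(G) = D is 3 * dH + 3 < 5 * D. *)
Theorem theorem1p2 :
  exists a b c n0 : nat, [/\ 0 < a, 0 < b & 0 < c] /\
    forall n D : nat, n0 <= n -> 1 <= D -> D ^ 11 <= n ->
      exists (T : finType) (e : rel T),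
        [/\ n <= a * #|T|, #|T| <= b * n, irreflexive e, diam_is e D &
          forall h : rel T, (forall u v, h u v -> e u v) ->
            forall dH : nat, diam_is h dH -> 3 * dH + 3 < 5 * D ->
              n ^ 4 * D <= c * nedges h ^ 3].
Proof.
exists 4, 4, 512, 2; split=> // n D n_ge2 D_gt0 le_Dn.
(* The construction has diameter at least 2. For D = 1 the complete graph works: the threshold
   forces [dH = 0], impossible with two vertices. *)
have [D1 | D_neq1] := eqVneq D 1.
  rewrite D1; exists 'I_n, (fun x y => x != y).
  rewrite card_ord; split; [lia | lia | by move=> x; rewrite eqxx | | ].
    exact: diam_complete.
  move=> h _ [|dH]; last by lia.
  move=> [walk_h _] _.
  by have /walk_le0[] := walk_h (Ordinal (ltnW n_ge2)) (Ordinal n_ge2).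
have le_D1n : D <= n by apply: leq_trans le_Dn; rewrite -{1}(expn1 D) leq_pexp2l.
have [q q_gt0 /andP[le_qn lt_nq]] := exists_square_scale D_gt0 le_D1n.
have le_n4q : n <= 4 * q ^ 2 * D.
  apply: leq_trans (ltnW lt_nq) _; rewrite leq_mul2r -(expnMn 2 q 2) leq_exp2r //.
  by lia.
(* As D is at least 2, c differs from a by at most one. *)
pose a := (D - 1) %/ 3; pose c := D - 2 * a - 2.
have defD : D = 2 * a + c + 2 by rewrite /c /a; lia.
have c_le : c <= a.+1 by rewrite /c /a; lia.
have a_le : a <= c.+2 by rewrite /c /a; lia.
exists (vertex 'I_q a c), (@edge 'I_q a c).
have cardT := card_vertex 'I_q a c; rewrite card_ord in cardT.
split; [ | | exact: edge_irreflexive | | ].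
- apply: leq_trans le_n4q _; rewrite cardT -mulnA !leq_mul2l; lia.
- rewrite cardT; apply: leq_trans (_ : q ^ 2 * (4 * D) <= _); last by lia.
  by rewrite leq_mul2l; lia.
- by rewrite [X in diam_is _ X]defD; apply: diam_edge => //; apply: Ordinal q_gt0.
move=> h h_sub d diam_h lt_d; apply: (edge_bound_arith D_gt0 le_Dn le_n4q).
rewrite -[q in q ^ 3]card_ord; apply: (nedges_lower_bound c_le h_sub a_le diam_h).
(* Otherwise [3 * d + 3 >= 9 * a + 6 * c + 12 >= 10 * a + 5 * c + 10 = 5 * D], by [a <= c.+2]. *)
by lia.
Qed.
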